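(* Let $a_1,\dots,a_n\in\mathbb{R}^d$ be the columns of $A\in\mathbb{R}^{d\times n}$, and consider the minimum enclosing ball problem $\min_{z\in\mathbb{R}^d,\,r\in\mathbb{R}} r^2$ subject to $\|z-a_i\|_2^2\le r^2$ for all $i$, with dual $$\min_{x\in\triangle}\ x^\top A^\top A x+c^\top x ,$$ where $\triangle=\{x\in\mathbb{R}^n:x_i\ge0,\ \sum_i x_i=1\}$ and $c\in\mathbb{R}^n$ has entries $c_i=-a_i^\top a_i$. Let $x^\star$ be an optimal solution of this dual problem. Then for every $x\in\triangle$ and every $i\in\{1,\dots,n\}$, $$(e_i-x)^\top(2A^\top Ax+c)>2\sqrt{\tfrac12\max_{1\le j\le n}(x-e_j)^\top(2A^\top Ax+c)}\ \,\|a_i-Ax\|_2\ \Longrightarrow\ x_i^\star=0 .$$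
   Context: $e_i$ denotes the $i$-th standard basis vector of $\mathbb{R}^n$; norms are Euclidean. Here $x\in\triangle$ is any feasible (current) iterate. *)

(* Defs.v *)
From mathcomp Require Export all_boot all_order all_algebra.
From mathcomp Require Export reals.

Set Implicit Arguments.
Unset Strict Implicit.
Unset Printing Implicit Defensive.

Import Order.TTheory GRing.Theory Num.Theory.
Local Open Scope ring_scope.

Definition dot (R : realType) (m : nat) (u v : 'cV[R]_m) : R :=
  (u^T *m v) 0 0.

(* The norm that MathComp-Analysis puts on matrices is the sup norm. *)
Definition norm2 (R : realType) (m : nat) (u : 'cV[R]_m) : R :=
  Num.sqrt (\sum_(k < m) u k 0 ^+ 2).

Definition simplex (R : realType) (n : nat) (x : 'cV[R]_n) : Prop :=
  (forall i, 0 <= x i 0) /\ \sum_(i < n) x i 0 = 1.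

Definition meb_c (R : realType) (d n : nat) (A : 'M[R]_(d, n)) : 'cV[R]_n :=
  \col_(i < n) - dot (col i A) (col i A).

(* Objective of the dual of the minimum enclosing ball problem
     min r^2  subject to  ||z - a_i||^2 <= r^2  for all i,
   where a_i = col i A. *)
Definition meb_dual (R : realType) (d n : nat) (A : 'M[R]_(d, n))
    (x : 'cV[R]_n) : R :=
  (x^T *m A^T *m A *m x) 0 0 + dot (meb_c A) x.

Definition meb_dual_optimal (R : realType) (d n : nat) (A : 'M[R]_(d, n))
    (xs : 'cV[R]_n) : Prop :=
  simplex xs /\ (forall y, simplex y -> meb_dual A xs <= meb_dual A y).

Definition basis_vec (R : realType) (n : nat) (i : 'I_n) : 'cV[R]_n :=
  delta_mx i 0.
Arguments basis_vec {R n} i.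

(* max_{1 <= j <= n} F j.  The fold starts from the term F i, so no value
   outside the family enters; the result does not depend on i, which only
   witnesses that the family is nonempty. *)
Definition max_at (R : realType) (n : nat) (i : 'I_n) (F : 'I_n -> R) : R :=
  \big[Num.max/F i]_(j < n) F j.

(* Main.v *)
(** Write [g] and [gs] for the gradients of the dual objective at [x] and at the
  optimum [xs], and [u = A (x - xs)].
  First-order optimality gives [(x - xs)^T gs >= 0], and, when [xs_i > 0],
  also [(x - e_i)^T gs >= 0], because [xs + xs_i (x - e_i)] is feasible.
  Since [g - gs = 2 A^T u], the second inequality yields
  [(e_i - x)^T g <= 2 (a_i - A x)^T u <= 2 |a_i - A x| |u|], while the first
  yields [2 |u|^2 = (x - xs)^T (g - gs) <= (x - xs)^T g], which is at most the
  maximum in the theorem because [xs] is a convex combination of the [e_j]. *)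
Require Import Defs.
From mathcomp Require Import ring lra.

Set Implicit Arguments.
Unset Strict Implicit.
Unset Printing Implicit Defensive.

Import Order.TTheory GRing.Theory Num.Theory.
Local Open Scope ring_scope.

Section Dot.
Variables (R : realType) (m : nat).
Implicit Types u v w : 'cV[R]_m.

Lemma dotE u v : dot u v = \sum_k u k 0 * v k 0.
Proof. by rewrite /dot mxE; apply: eq_bigr => k _; rewrite mxE. Qed.

Lemma dotC u v : dot u v = dot v u.
Proof. by rewrite !dotE; apply: eq_bigr => k _; rewrite mulrC. Qed.

Lemma dotDl u v w : dot (u + v) w = dot u w + dot v w.
Proof. by rewrite /dot linearD mulmxDl mxE. Qed.

Lemma dotZl a u v : dot (a *: u) v = a * dot u v.
Proof. by rewrite /dot linearZ /= -scalemxAl mxE. Qed.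

Lemma dotNl u v : dot (- u) v = - dot u v.
Proof. by rewrite -scaleN1r dotZl mulN1r. Qed.

Lemma dotBl u v w : dot (u - v) w = dot u w - dot v w.
Proof. by rewrite dotDl dotNl. Qed.

Lemma dotDr u v w : dot w (u + v) = dot w u + dot w v.
Proof. by rewrite !(dotC w) dotDl. Qed.

Lemma dotZr a u v : dot u (a *: v) = a * dot u v.
Proof. by rewrite !(dotC u) dotZl. Qed.

Lemma dotBr u v w : dot w (u - v) = dot w u - dot w v.
Proof. by rewrite !(dotC w) dotBl. Qed.

Lemma dot_ge0 u : 0 <= dot u u.
Proof. by rewrite dotE sumr_ge0 // => k _; rewrite -expr2 sqr_ge0. Qed.

Lemma norm2E u : norm2 u = Num.sqrt (dot u u).
Proof. by rewrite /norm2 dotE; under eq_bigr do rewrite expr2. Qed.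

Lemma norm2_ge0 u : 0 <= norm2 u.
Proof. exact: sqrtr_ge0. Qed.

Lemma norm2_sqr u : norm2 u ^+ 2 = dot u u.
Proof. by rewrite norm2E sqr_sqrtr ?dot_ge0. Qed.

Lemma norm2_eq0 u : norm2 u = 0 -> u = 0.
Proof.
move=> u0; have /eqP := norm2_sqr u.
rewrite u0 expr0n /= eq_sym dotE psumr_eq0 => [/allP uu0|k _]; last first.
  by rewrite -expr2 sqr_ge0.
apply/matrixP => k j; rewrite ord1 mxE.
by have := uu0 k (mem_index_enum k); rewrite -expr2 sqrf_eq0 => /eqP.
Qed.

Lemma dot0l u : dot 0 u = 0.
Proof. by rewrite -(scale0r u) dotZl mul0r. Qed.

(** Cauchy-Schwarz: expand [0 <= | |v| u - |u| v |^2] and cancel the factor [|u| |v|], which is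
    positive once the zero vectors are set aside. *)
Lemma dot_le_norm2 u v : dot u v <= norm2 u * norm2 v.
Proof.
have [/norm2_eq0 ->|u0] := eqVneq (norm2 u) 0.
  by rewrite dot0l mulr_ge0 ?norm2_ge0.
have [/norm2_eq0 ->|v0] := eqVneq (norm2 v) 0.
  by rewrite dotC dot0l mulr_ge0 ?norm2_ge0.
have uv_gt0 : 0 < norm2 u * norm2 v.
  by rewrite mulr_gt0 // lt_neqAle eq_sym norm2_ge0 andbT.
have := dot_ge0 (norm2 v *: u - norm2 u *: v).
rewrite !(dotBl, dotBr, dotZl, dotZr) (dotC v u) -!norm2_sqr => h.
by rewrite -(ler_pM2l uv_gt0); nra.
Qed.

Lemma dot_basis_vec (i : 'I_m) u : dot (basis_vec i) u = u i 0.
Proof.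
rewrite dotE (bigD1 i) //= big1 => [|k ki].
  by rewrite addr0 /basis_vec mxE !eqxx mul1r.
by rewrite /basis_vec mxE (negbTE ki) mul0r.
Qed.

End Dot.

Lemma dot_adj (R : realType) (d n : nat) (A : 'M[R]_(d, n)) u v :
  dot v (A^T *m u) = dot (A *m v) u.
Proof. by rewrite /dot trmx_mul mulmxA. Qed.

Lemma max_at_ge (R : realType) (n : nat) (i j : 'I_n) (F : 'I_n -> R) :
  F j <= max_at i F.
Proof. exact: (le_bigmax _ F j). Qed.

Section Simplex.
Variables (R : realType) (n : nat).
Implicit Types x y v g : 'cV[R]_n.

(** Convexity: the point is [(1 - t) x + t (x + v)]. *)
Lemma simplex_line x v (t : R) :
  simplex x -> simplex (x + v) -> 0 <= t <= 1 -> simplex (x + t *: v).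
Proof.
move=> [x0 x1] [y0 y1] /andP[t0 t1]; split=> [k|].
  by have := x0 k; have := y0 k; rewrite !mxE; nra.
have : \sum_i (x + v) i 0 = 1 + \sum_i v i 0.
  by rewrite -x1 -big_split; apply: eq_bigr => k _; rewrite mxE.
rewrite y1 => v0.
have -> : \sum_i (x + t *: v) i 0 = \sum_i x i 0 + t * \sum_i v i 0.
  by rewrite mulr_sumr -big_split; apply: eq_bigr => k _; rewrite !mxE.
rewrite x1; nra.
Qed.

(** The mass [x_i] is taken off coordinate [i] and spread according to [y]: coordinate [i] becomes
    [x_i y_i], every other one [x_k + x_i y_k]. *)
Lemma simplex_shift x y (i : 'I_n) :
  simplex x -> simplex y -> simplex (x + x i 0 *: (y - basis_vec i)).
Proof.
move=> [x0 x1] [y0 y1]; split=> [k|].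
  rewrite !mxE; have [->|ki] /= := eqVneq k i.
    by have := mulr_ge0 (x0 i) (y0 i); lra.
  by rewrite subr0 addr_ge0 ?mulr_ge0.
under eq_bigr do rewrite !mxE.
rewrite big_split /= x1 -mulr_sumr sumrB y1 (bigD1 i) //= !eqxx big1 => [|k ki].
  by rewrite addr0 subrr mulr0 addr0.
by rewrite (negbTE ki).
Qed.

(** Since the weights [y_j] sum to 1, [x - y] is the average of the [x - e_j] with these weights,
    and an average is at most the maximum. *)
Lemma simplex_gap_le x y g (i : 'I_n) : simplex y ->
  dot (x - y) g <= max_at i (fun j => dot (x - basis_vec j) g).
Proof.
move=> [y0 y1]; set M := max_at _ _.
have -> : dot (x - y) g = \sum_j y j 0 * dot (x - basis_vec j) g.
  rewrite dotBl (dotE y) -[dot x g]mul1r -y1 mulr_suml -sumrB.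
  by apply: eq_bigr => j _; rewrite dotBl dot_basis_vec mulrBr.
rewrite -[leRHS]mul1r -y1 mulr_suml.
apply: ler_sum => j _; rewrite ler_wpM2l //.
exact: (max_at_ge i j (fun j => dot (x - basis_vec j) g)).
Qed.

End Simplex.

Section DualGradient.
Variables (R : realType) (d n : nat) (A : 'M[R]_(d, n)).

Definition meb_grad (x : 'cV[R]_n) : 'cV[R]_n :=
  2 *: (A^T *m A *m x) + meb_c A.

Lemma meb_gradB x y v : dot v (meb_grad x) - dot v (meb_grad y) =
  2 * dot (A *m v) (A *m (x - y)).
Proof.
rewrite !dotDr !dotZr -!mulmxA !dot_adj mulmxBr dotBr; ring.
Qed.

(** The second-order Taylor expansion, exact because the objective is quadratic. *)
Lemma meb_dual_line x v (t : R) : meb_dual A (x + t *: v) =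
  meb_dual A x + t * dot v (meb_grad x) + t ^+ 2 * dot (A *m v) (A *m v).
Proof.
have dualE y : meb_dual A y = dot (A *m y) (A *m y) + dot (meb_c A) y.
  by rewrite /meb_dual /dot trmx_mul !mulmxA.
rewrite !dualE mulmxDr -scalemxAr !(dotDl, dotDr, dotZl, dotZr).
rewrite -mulmxA dot_adj (dotC (A *m x) (A *m v)) (dotC v (meb_c A)); ring.
Qed.

Lemma meb_dual_optimal_grad xs v :
  meb_dual_optimal A xs -> simplex (xs + v) -> 0 <= dot v (meb_grad xs).
Proof.
move=> [sxs opt] sv; rewrite leNgt; apply/negP => l0.
have := dot_ge0 (A *m v).
set q := dot (A *m v) _; set l := dot v _ in l0 * => q0.
(* Chosen in [0, 1] so that [l + t q = t l < 0]. *)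
pose t := - l / (q - l).
have ql0 : 0 < q - l by lra.
have tE : t * (q - l) = - l by rewrite divfK // gt_eqF.
have t0 : 0 < t by rewrite divr_gt0 //; lra.
have t1 : t <= 1 by rewrite ler_pdivrMr //; lra.
have t01 : 0 <= t <= 1 by rewrite ltW.
have := opt _ (simplex_line sxs sv t01).
rewrite meb_dual_line -/q -/l => h.
(* The step changes the objective by [t (l + t q) = t (t l)], which is negative, whereas [h] makes
   this change nonnegative. *)
have lt0 : t * (t * l) < 0 by rewrite !pmulr_rlt0.
have : l + t * q = t * l by lra.
by move=> ltq; move: lt0; rewrite -ltq; lra.
Qed.

End DualGradient.

Theorem corollary9 (R : realType) (d n : nat) (A : 'M[R]_(d, n))
    (xs : 'cV[R]_n) (hxs : meb_dual_optimal A xs)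
    (x : 'cV[R]_n) (hx : simplex x) (i : 'I_n) :
  let g : 'cV[R]_n := 2 *: (A^T *m A *m x) + meb_c A in
  dot (basis_vec i - x) g
    > 2 * Num.sqrt (2^-1 * max_at i (fun j => dot (x - basis_vec j) g))
        * norm2 (col i A - A *m x) ->
  xs i 0 = 0.
Proof.
move=> g; rewrite -/(meb_grad A x) in g *; apply: contraTeq => xsi0.
rewrite -leNgt; have [sxs _] := hxs.
have xsi_gt0 : 0 < xs i 0 by rewrite lt_neqAle eq_sym xsi0 sxs.1.
have opt_i : 0 <= dot (x - basis_vec i) (meb_grad A xs).
  have := meb_dual_optimal_grad hxs (simplex_shift i sxs hx).
  by rewrite dotZl pmulr_rge0.
have opt_x : 0 <= dot (x - xs) (meb_grad A xs).
  by apply: meb_dual_optimal_grad hxs _; rewrite addrC subrK.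
pose u := A *m (x - xs).
have gap := simplex_gap_le x g i sxs.
have u_le : norm2 u <=
    Num.sqrt (2^-1 * max_at i (fun j => dot (x - basis_vec j) g)).
  rewrite norm2E ler_wsqrtr // -/u.
  by have := meb_gradB A x xs (x - xs); rewrite -/g -/u; lra.
(* With [a_i = A e_i], the vector [a_i - A x] is the image of the direction [e_i - x], so
   [meb_gradB] applies to it. *)
have -> : col i A = A *m basis_vec i by rewrite colE.
rewrite -mulmxBr; set a := A *m _.
have := meb_gradB A x xs (basis_vec i - x); rewrite -/g -/u -/a => gE.
have := dot_le_norm2 a u; have := ler_wpM2r (norm2_ge0 a) u_le.
move: opt_i; rewrite -[x - _]opprB dotNl; lra.
Qed.
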